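(* Let $P$ and $Q$ be transition kernels on the same finite labelled state space $S=\{1,\dots,n\}$ with the same labelled action sets $A(s)$ and the same discount factor $\gamma\in(0,1)$. The following are equivalent: (i) $P\equiv_{\mathrm{sa}}Q$; (ii) $\mathcal U_P(\pi)=\mathcal U_Q(\pi)$ for every deterministic policy $\pi$.
   Context: $S=\{1,\dots,n\}$ is a finite set of states; each state $s$ has a finite nonempty action set $A(s)$; $\gamma\in(0,1)$ is fixed. A transition kernel $P$ assigns to each $s\in S$, $a\in A(s)$ a row vector $P_{s,a}=P(\cdot\mid s,a)\in\mathbb R^{1\times n}$ with nonnegative entries summing to $1$. A (stationary) deterministic policy $\pi$ chooses $\pi(s)\in A(s)$ for each $s$. A state--action reward is a family of real numbers $r(s,a)$, $s\in S$, $a\in A(s)$. The optimal value $V_{P,r}^*\in\mathbb R^n$ is the unique vector with $V_{P,r}^*(s)=\max_{a\in A(s)}\{r(s,a)+\gamma P_{s,a}V_{P,r}^*\}$ for all $s$, and $\operatorname{Opt}_{P,r}(s)=\arg\max_{a\in A(s)}\{r(s,a)+\gamma P_{s,a}V_{P,r}^*\}\subseteq A(s)$. $P\equiv_{\mathrm{sa}}Q$ means $\operatorname{Opt}_{P,r}(s)=\operatorname{Opt}_{Q,r}(s)$ for every state--action reward $r$ and every $s\in S$. For a deterministic policy $\pi$, $\mathcal U_P(\pi)$ is the set of state--action rewards $r$ such that $\operatorname{Opt}_{P,r}(s)=\{\pi(s)\}$ for every $s\in S$. *)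

(* Defs.v *)
From HB Require Import structures.
From mathcomp Require Import all_boot all_order all_algebra.
From mathcomp Require Import all_classical all_reals all_analysis.
Import Order.TTheory GRing.Theory Num.Theory numFieldNormedType.Exports.

Local Open Scope classical_set_scope.
Local Open Scope ring_scope.

Section MDP.
Context {R : realType} {n : nat} {A : 'I_n -> finType}.

Definition kernel_family := forall s : 'I_n, A s -> 'rV[R]_n.

Definition is_transition_kernel (P : kernel_family) : Prop :=
  forall s (a : A s), (forall t, 0 <= P s a 0 t) /\ \sum_t P s a 0 t = 1.

Definition reward := forall s : 'I_n, A s -> R.

Definition policy := forall s : 'I_n, A s.

Variable gamma : R.

Definition qvalue (P : kernel_family) (r : reward) (V : 'cV[R]_n)
    {s : 'I_n} (a : A s) : R :=
  r s a + gamma * (P s a *m V) 0 0.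

Definition is_max (E : set R) (m : R) : Prop := E m /\ ubound E m.

Definition bellman (P : kernel_family) (r : reward) (V : 'cV[R]_n) : Prop :=
  forall s, is_max (range (qvalue P r V (s := s))) (V s 0).

(* The default value [0] is never used: see [bellman_opt_value] and
   [opt_value_unique]. *)
Definition opt_value (P : kernel_family) (r : reward) : 'cV[R]_n :=
  xget 0 [set V | bellman P r V].

Definition Opt (P : kernel_family) (r : reward) (s : 'I_n) : set (A s) :=
  let q := qvalue P r (opt_value P r) (s := s) in
  [set a | forall b, q b <= q a].

Definition sa_equiv (P Q : kernel_family) : Prop :=
  forall (r : reward) (s : 'I_n), Opt P r s = Opt Q r s.

Definition unique_opt_rewards (P : kernel_family) (pi : policy) : set reward :=
  [set r | forall s, Opt P r s = [set pi s]].

Section WellDefined.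
Hypothesis A_gt0 : forall s, (0 < #|A s|)%N.
Hypothesis gamma01 : 0 < gamma < 1.
Variables (P : kernel_family) (r : reward).
Hypothesis HP : is_transition_kernel P.

Lemma qvalue_dist V W s (a : A s) :
  qvalue P r V a - qvalue P r W a <= gamma * `|V - W|.
Proof.
have /andP[g0 _] := gamma01.
rewrite /qvalue opprD addrACA subrr add0r -mulrBr ler_pM2l//.
have [P0 P1] := HP _ a.
rewrite !mxE -sumrB -[leRHS]mul1r -P1 mulr_suml ler_sum// => t _.
rewrite -mulrBr ler_wpM2l//; apply: (le_trans (ler_norm _)).
rewrite [leRHS]/Num.Def.normr/= mx_normrE; apply/bigmax_geP; right => /=.
by exists (t, 0) => //; rewrite !mxE.
Qed.

Lemma is_max_dist V W s x y :
  is_max (range (qvalue P r V (s := s))) x ->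
  is_max (range (qvalue P r W (s := s))) y -> `|x - y| <= gamma * `|V - W|.
Proof.
move=> [[a _ <-] ubx] [[b _ <-] uby]; rewrite ler_norml; apply/andP; split.
  rewrite lerNl opprB distrC; apply: le_trans (qvalue_dist W V s b).
  by rewrite lerB//; apply: ubx; exists b.
apply: le_trans (qvalue_dist V W s a).
by rewrite lerB//; apply: uby; exists a.
Qed.

Lemma max_dist (T T' V W : 'cV[R]_n) :
  (forall s, is_max (range (qvalue P r V (s := s))) (T s 0)) ->
  (forall s, is_max (range (qvalue P r W (s := s))) (T' s 0)) ->
  `|T - T'| <= gamma * `|V - W|.
Proof.
move=> HT HT'; have /andP[g0 _] := gamma01.
rewrite [leLHS]/Num.Def.normr/= mx_normrE; apply: bigmax_le => [|[s j] _ /=].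
  by rewrite mulr_ge0// ltW.
by rewrite ord1 !mxE; apply: is_max_dist.
Qed.

Lemma bellman_unique V W : bellman P r V -> bellman P r W -> V = W.
Proof.
move=> HV HW; have /andP[g0 g1] := gamma01.
have := max_dist _ _ _ _ HV HW; rewrite -subr_ge0 -[X in _ - X]mul1r -mulrBl.
rewrite nmulr_rge0 ?subr_lt0// normr_le0 subr_eq0 => /eqP //.
Qed.

Lemma bellman_exists : exists V, bellman P r V.
Proof.
have /andP[g0 g1] := gamma01.
have [T HT] : exists T : 'cV[R]_n -> 'cV[R]_n, forall V s,
    is_max (range (qvalue P r V (s := s))) (T V s 0).
  suff H V s : exists m, is_max (range (qvalue P r V (s := s))) m.
    exists (fun V => \col_s projT1 (cid (H V s))) => V s.
    by rewrite mxE; case: cid.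
  have /card_gt0P[a0 _] := A_gt0 s.
  case: (@arg_maxP _ _ _ a0 xpredT (@qvalue P r V s)) => // a _ Ha.
  exists (qvalue P r V a); split; first by exists a.
  by move=> _ [b _ <-]; apply: Ha.
have subT : {homo T : V / [set: 'cV[R]_n] V >-> [set: 'cV[R]_n] V} by [].
pose X : completeNormedModType R := HB.pack 'cV[R]_n
  (NormedModule.on 'cV[R]_n) (Complete.on 'cV[R]_n).
have [|||V _ VE] := @banach_fixed_point R X setT (mkfun_fun subT).
- exists (NngNum (ltW g0)); split=> // -[V W] _ /=.
  exact: max_dist.
- exact: closedT.
- by exists 0.
- by exists V => s; rewrite {2}VE; apply: HT.
Qed.

Lemma bellman_opt_value : bellman P r (opt_value P r).
Proof. exact: xgetPex bellman_exists. Qed.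

Lemma opt_value_unique V : bellman P r V -> V = opt_value P r.
Proof. by move=> HV; exact: bellman_unique HV bellman_opt_value. Qed.

End WellDefined.
End MDP.

Arguments kernel_family R {n} A.
Arguments reward R {n} A.
Arguments policy {n} A.

(* Main.v *)
(* If [pi] is optimal for [(P, r)], lowering the reward of every action not
   chosen by [pi] by [e > 0] keeps the optimal value for [P] and makes [pi] the
   only optimal policy.  By (ii), [pi] is then the only optimal policy for [Q]
   and every penalized reward.  The corresponding optimal value for [Q] is the
   value of [pi], which does not depend on [e]; letting [e] tend to 0 in the
   Bellman inequalities shows that [pi] is optimal for [(Q, r)]. *)
Require Import Defs.
From mathcomp Require Import all_boot all_order all_algebra.
From mathcomp Require Import all_classical all_reals all_analysis.
From mathcomp Require Import lra.
Import Order.TTheory GRing.Theory Num.Theory.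

Local Open Scope classical_set_scope.
Local Open Scope ring_scope.

Section Penalization.
Context {R : realType} {n : nat} {A : 'I_n -> finType}.
Hypothesis A_gt0 : forall s, (0 < #|A s|)%N.
Variable gamma : R.
Hypothesis gamma01 : 0 < gamma < 1.
Implicit Types (P Q : kernel_family R A) (r : reward R A) (pi : policy A).
Implicit Types (V : 'cV[R]_n) (e : R).

Definition penalize r pi e : reward R A :=
  fun s a => r s a - (if a == pi s then 0 else e).

Lemma qvalue_penalize P r pi e V s (a : A s) :
  qvalue gamma P (penalize r pi e) V a =
  qvalue gamma P r V a - (if a == pi s then 0 else e).
Proof. by rewrite /qvalue /penalize addrAC. Qed.

(** Some action attains the Bellman maximum, so optimality, a family of inequalities, becomes one
    equation. *)
Lemma OptE P r s (a : A s) : is_transition_kernel P ->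
  Opt gamma P r s a <->
  qvalue gamma P r (opt_value gamma P r) a = opt_value gamma P r s 0.
Proof.
move=> HP; have [[b _ qb] ubV] := bellman_opt_value gamma A_gt0 gamma01 P r HP s.
split=> [opt_a|qa c]; last by rewrite qa; apply: ubV; exists c.
by apply/le_anti; rewrite -{2}qb opt_a andbT; apply: ubV; exists a.
Qed.

(** The maximum is attained at [pi s], which is not penalized, and the other entries only decrease.
    Allowing [e = 0] matters: the lemma is later applied with penalty [1 - e], where [e <= 1]. *)
Lemma bellman_penalize P r pi e V : 0 <= e -> bellman gamma P r V ->
  (forall s, qvalue gamma P r V (pi s) = V s 0) ->
  bellman gamma P (penalize r pi e) V.
Proof.
move=> e0 HV Vpi s; split.
  by exists (pi s) => //; rewrite qvalue_penalize eqxx subr0.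
move=> _ [b _ <-]; rewrite qvalue_penalize.
have : qvalue gamma P r V b <= V s 0 by have [_] := HV s; apply; exists b.
by case: ifP => _; lra.
Qed.

Lemma unique_opt_penalize P r pi e : is_transition_kernel P -> 0 < e ->
  (forall s, Opt gamma P r s (pi s)) ->
  unique_opt_rewards gamma P pi (penalize r pi e).
Proof.
move=> HP e0 opt_pi; set V := opt_value gamma P r.
have Vpi s : qvalue gamma P r V (pi s) = V s 0 by apply/OptE.
have HV : bellman gamma P r V := bellman_opt_value gamma A_gt0 gamma01 P r HP.
have VE : opt_value gamma P (penalize r pi e) = V.
  apply/esym/(opt_value_unique gamma A_gt0 gamma01 _ _ HP).
  exact: bellman_penalize (ltW e0) HV Vpi.
move=> s; apply/seteqP; split=> [a|_ ->]; last first.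
  by apply/OptE => //; rewrite VE qvalue_penalize eqxx subr0.
move/(OptE _ _ _ _ HP); rewrite VE qvalue_penalize.
have : qvalue gamma P r V a <= V s 0 by have [_] := HV s; apply; exists a.
by case: eqP => // _; lra.
Qed.

Lemma opt_of_unique_opt_penalize Q r pi : is_transition_kernel Q ->
  (forall e, 0 < e -> unique_opt_rewards gamma Q pi (penalize r pi e)) ->
  forall s, Opt gamma Q r s (pi s).
Proof.
move=> HQ uniq_pi; pose W e := opt_value gamma Q (penalize r pi e).
have HW e : bellman gamma Q (penalize r pi e) (W e).
  exact: (bellman_opt_value gamma A_gt0 gamma01).
have Wpi e s : 0 < e -> qvalue gamma Q (penalize r pi e) (W e) (pi s) = W e s 0.
  by move=> e0; apply/OptE => //; rewrite uniq_pi.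
(* Penalty 1 is penalty [e] followed by penalty [1 - e]; the second one preserves [W e], as [pi]
   attains it. *)
have W1 e : 0 < e <= 1 -> W e = W 1.
  move=> /andP[e0 e1]; apply: (opt_value_unique gamma A_gt0 gamma01 _ _ HQ).
  have -> : penalize r pi 1 = penalize (penalize r pi e) pi (1 - e).
    by apply: functional_extensionality_dep => s; apply/funext => a;
       rewrite /penalize; case: ifP => _; lra.
  by apply: bellman_penalize (HW e) _ => [|s]; [lra|exact: Wpi].
have Vpi s : qvalue gamma Q r (W 1) (pi s) = W 1 s 0.
  by rewrite -Wpi ?ltr01// qvalue_penalize eqxx subr0.
have HV : bellman gamma Q r (W 1).
  move=> s; split; first by exists (pi s).
  move=> _ [b _ <-]; apply/ler_addgt0Pr => d d0.
  (* The bound [e <= 1] lets [W 1] replace [W e]; [e <= d] absorbs the penalty into the slack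
     [d]. *)
  have [e [e0 e1 ed]] : exists e, [/\ 0 < e, e <= 1 & e <= d].
    by exists (Num.min d 1); rewrite lt_min d0 ltr01 !ge_min !lexx orbT.
  have : qvalue gamma Q (penalize r pi e) (W 1) b <= W 1 s 0.
    by rewrite -(W1 e) ?e0//; have [_] := HW e s; apply; exists b.
  by rewrite qvalue_penalize; case: ifP => _; lra.
by move=> s; apply/OptE; rewrite // -(opt_value_unique gamma A_gt0 gamma01 _ _ HQ _ HV).
Qed.

Lemma Opt_sub_of_unique_opt P Q r s :
  is_transition_kernel P -> is_transition_kernel Q ->
  (forall pi, unique_opt_rewards gamma P pi `<=` unique_opt_rewards gamma Q pi) ->
  Opt gamma P r s `<=` Opt gamma Q r s.
Proof.
move=> HP HQ sub_PQ a opt_a.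
have opt_ex t : exists b, Opt gamma P r t b.
  have [[b _ qb] _] := bellman_opt_value gamma A_gt0 gamma01 P r HP t.
  by exists b; apply/OptE.
(* An optimal policy through the given action: [a] at [s], any optimal action at each other
   state. *)
pose pi := eqtype.dfwith (fun t => projT1 (cid (opt_ex t))) a.
have opt_pi t : Opt gamma P r t (pi t).
  by rewrite /pi; case: eqtype.dfwithP => // u _; case: cid.
have <- : pi s = a by rewrite /pi eqtype.dfwith_in.
apply: opt_of_unique_opt_penalize => // e e0.
by apply: sub_PQ; exact: unique_opt_penalize.
Qed.

End Penalization.

Theorem corollaryA2 (R : realType) (n : nat) (A : 'I_n -> finType)
  (A_gt0 : forall s, (0 < #|A s|)%N)
  (gamma : R) (gamma01 : 0 < gamma < 1)
  (P Q : kernel_family R A)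
  (HP : is_transition_kernel P) (HQ : is_transition_kernel Q) :
  sa_equiv gamma P Q <->
  (forall pi : policy A,
     unique_opt_rewards gamma P pi = unique_opt_rewards gamma Q pi).
Proof.
split=> [PQ pi|U_PQ r s].
  by apply/seteqP; split=> r Ur s; rewrite -Ur PQ.
by apply/seteqP; split; apply: Opt_sub_of_unique_opt => // pi; rewrite U_PQ.
Qed.
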